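(* Let $gA_n$ be a coset of the alternating group $A_n$ in the symmetric group $S_n$. 1. For $2\le k\le n/2$, the proportion of elements in $gA_n$ which are derangements on $k$-sets is at least $1/3$. 2. For $n\ge 5$ and $k=1$, the proportion of elements in $gA_n$ without fixed points is at least $1/3$. In particular, when $n \geq 5$ (so that $A_n$ is simple), for every $1\le k\le n/2$ the proportion of derangements on $k$-sets in a coset $gA_n$ is at least $1/3$.
   Context: $S_n$ acts on the $k$-element subsets ($k$-sets) of $\{1,\dots,n\}$. A permutation is a derangement on $k$-sets if it leaves no $k$-element subset invariant (as a set). *)

(* Defs.v *)
From HB Require Import structures.
From mathcomp Require Import all_boot all_order all_algebra all_fingroup.
From mathcomp Require Import all_solvable.
Set Implicit Arguments.
Unset Strict Implicit.
Unset Printing Implicit Defensive.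

Definition kset_derangement (n k : nat) (s : 'S_n) : bool :=
  [forall S : {set 'I_n}, (#|S| == k) ==> (s @: S != S)].

Definition fixed_point_free (n : nat) (s : 'S_n) : bool :=
  [forall i : 'I_n, s i != i].

Definition proportion (T : finType) (C : {set T}) (P : pred T) : rat :=
  (#|[set x in C | P x]|%:R / #|C|%:R)%R.

(* Main.v *)
(* Write an element of S_n in cycle notation and let m be the number of points lying
   on cycles of length at most k. If m < k, no k-set is invariant, because an invariant
   k-set consists of such points. If c(N) is the proportion of S_N with all cycles longer
   than k, the proportion of S_n with m < k is c(n) + c(n-1) + ... + c(n-k+1). Removing
   the cycle through a given point gives N c(N) = c(0) + ... + c(N-k-1), hence
     N c(N) = (N-1) c(N-1) + c(N-k-1),
   so c(N) >= 1/(2k+1) for N > k, and the sum is at least k/(2k+1) >= 1/3 when n >= 2k.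
   To restrict to a coset of A_n, do the same count with each permutation weighted by its
   sign. The signed sum over S_m vanishes for m > 1, so the correction is d(n) + d(n-1)
   (only d(n) if k = 1), where d satisfies the recursion of c up to signs. It is at most
   2/(n(k+1)), which is small enough unless k = 1, or k = 2 and n < 10; there the first
   terms of the recursions are computed. The bound 1/3 is attained at k = 1, n = 5 and
   at k = 2, n = 6. *)
Require Import Defs.
From HB Require Import structures.
From mathcomp Require Import all_boot all_order all_algebra all_fingroup.
From mathcomp Require Import all_solvable.
From mathcomp Require Import zify ring lra.
Set Implicit Arguments.
Unset Strict Implicit.
Unset Printing Implicit Defensive.

Import Order.TTheory GRing.Theory Num.Theory.
Local Open Scope ring_scope.

(** * Splitting permutations along an invariant subset, and sums of signs *)

Section PermutationSums.

Variable T : finType.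
Implicit Types (A B D : {set T}) (s u v : {perm T}).

Lemma disjoint_setDr A B : [disjoint B & A :\: B].
Proof. by rewrite disjoint_subset; apply/subsetP=> x xB; rewrite !inE xB. Qed.

Lemma mem_setstab B s : s @: B = B -> s \in ('N(B | 'P))%g.
Proof.
move=> sB; rewrite !inE /=; apply/subsetP=> x xB; rewrite inE /= /aperm -sB.
exact: imset_f.
Qed.

Lemma perm_on_mull_in B D u v x : perm_on B u -> perm_on D v ->
  [disjoint B & D] -> x \in B -> (u * v)%g x = u x.
Proof.
move=> uB vD dBD xB; rewrite permM (out_perm vD) //.
by rewrite (disjointFr dBD) // perm_closed.
Qed.

Lemma perm_on_mulr_in B D u v x : perm_on B u -> perm_on D v ->
  [disjoint B & D] -> x \in D -> (u * v)%g x = v x.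
Proof.
move=> uB vD dBD xD; rewrite permM (out_perm uB) //.
by rewrite (disjointFl dBD).
Qed.

Lemma perm_on_mul_im B D u v : perm_on B u -> perm_on D v ->
  [disjoint B & D] -> (u * v)%g @: B = B.
Proof.
move=> uB vD dBD; rewrite -[RHS](im_perm_on uB); apply: eq_in_imset => x xB.
exact: perm_on_mull_in vD dBD xB.
Qed.

Lemma perm_on_expg B u i : perm_on B u -> perm_on B (u ^+ i)%g.
Proof.
move=> uB; elim: i => [|i IH]; first exact: perm_on1.
by rewrite expgS perm_onM.
Qed.

Lemma porbit_mull B D u v x : perm_on B u -> perm_on D v ->
  [disjoint B & D] -> x \in B -> porbit (u * v)%g x = porbit u x.
Proof.
move=> uB vD dBD xB; have iter_uv i : ((u * v) ^+ i)%g x = (u ^+ i)%g x.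
  rewrite expgMn; last exact: perm_onC uB vD dBD.
  exact: perm_on_mull_in (perm_on_expg i uB) (perm_on_expg i vD) dBD xB.
by apply/setP=> y; apply/porbitP/porbitP=> -[i ->]; exists i; rewrite iter_uv.
Qed.

Lemma porbit_mulr B D u v x : perm_on B u -> perm_on D v ->
  [disjoint B & D] -> x \in D -> porbit (u * v)%g x = porbit v x.
Proof.
move=> uB vD dBD xD; have -> : (u * v)%g = (v * u)%g by exact: perm_onC dBD.
by apply: (porbit_mull vD uB _ xD); rewrite disjoint_sym.
Qed.

Lemma porbit_sub A s x : perm_on A s -> x \in A -> porbit s x \subset A.
Proof.
move=> sA xA; apply/subsetP=> _ /porbitP[i ->].
by rewrite perm_closed // perm_on_expg.
Qed.

Lemma im_porbit s x : s @: porbit s x = porbit s x.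
Proof.
apply/eqP; rewrite eqEcard card_imset ?leqnn ?andbT; last exact: perm_inj.
apply/subsetP=> _ /imsetP[_ /porbitP[i ->] ->].
by rewrite -permM -expgSr mem_porbit.
Qed.

Lemma restr_perm_mull B D u v : perm_on B u -> perm_on D v ->
  [disjoint B & D] -> restr_perm B (u * v)%g = u.
Proof.
move=> uB vD dBD; apply/permP=> x; have [xB|xNB] := boolP (x \in B).
  rewrite restr_permE //; first exact: perm_on_mull_in vD dBD xB.
  exact: mem_setstab (perm_on_mul_im uB vD dBD).
by rewrite (out_perm (restr_perm_on B _)) // (out_perm uB).
Qed.

(** A permutation of [A] that stabilises [B] is uniquely a product of a permutation of [B] and one
    of [A :\: B]; the two restrictions invert the multiplication. *)
Lemma sum_perm_on_stab A B (R : nmodType) (F : {perm T} -> R) : B \subset A ->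
  \sum_(s | perm_on A s && (s @: B == B)) F s =
  \sum_(u | perm_on B u) \sum_(v | perm_on (A :\: B) v) F (u * v)%g.
Proof.
move=> BA; set D := A :\: B.
have dBD : [disjoint B & D] by exact: disjoint_setDr.
rewrite pair_big /= (reindex_onto (fun p => (p.1 * p.2)%g)
  (fun s => (restr_perm B s, restr_perm D s))) /=.
  apply: eq_bigl => -[u v] /=; apply/andP/andP.
    by move=> [_ /eqP[<- <-]]; rewrite !restr_perm_on.
  move=> [uB vD]; split; last first.
    rewrite (restr_perm_mull uB vD) //.
    have -> : (u * v)%g = (v * u)%g by exact: perm_onC dBD.
    by rewrite (restr_perm_mull vD uB) // disjoint_sym.
  rewrite (perm_on_mul_im uB vD) // eqxx andbT perm_onM //.
    exact: subset_trans uB BA.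
  exact: subset_trans vD (subsetDl _ _).
move=> s /andP[sA /eqP sB]; have sD : s @: D = D.
  apply/eqP; rewrite eqEcard card_imset ?leqnn ?andbT; last exact: perm_inj.
  apply/subsetP=> _ /imsetP[x /setDP[xA xNB] ->].
  rewrite inE (perm_closed _ sA) xA andbT; apply: contra xNB.
  by rewrite -{1}sB => /imsetP[y yB /perm_inj->].
have rB := @restr_permE T B s _ (mem_setstab sB).
have rD := @restr_permE T D s _ (mem_setstab sD).
apply/permP=> x; have [xB|xNB] := boolP (x \in B).
  by rewrite (perm_on_mull_in (restr_perm_on B s) (restr_perm_on D s)) ?rB.
have [xD|xND] := boolP (x \in D).
  by rewrite (perm_on_mulr_in (restr_perm_on B s) (restr_perm_on D s)) ?rD.
have xNA : x \notin A by apply: contra xND => xA; rewrite inE xNB.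
rewrite permM (out_perm (restr_perm_on B s)) // (out_perm (restr_perm_on D s)) //.
by rewrite (out_perm sA).
Qed.

(* [e] selects between counting ([e = false]) and counting with signs ([e = true]). *)
Definition weight (e : bool) s : rat := (-1) ^+ (e && odd_perm s).

Lemma weightM e u v : weight e (u * v)%g = weight e u * weight e v.
Proof. by rewrite /weight odd_permM; case: e; rewrite ?mulr1 ?signr_addb. Qed.

(** With two points in [A], multiplying by their transposition flips every sign, so the signed sum
    is its own negative. With at most one point only the identity remains. *)
Lemma sum_weight_perm_on e A :
  \sum_(s | perm_on A s) weight e s = (e ==> (#|A| <= 1)%N)%:R * (#|A|`!)%:R.
Proof.
case: e => /=; last first.
  by rewrite mul1r -card_perm -sum1_card natr_sum; apply: eq_bigr.
have [A1|] := leqP #|A| 1.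
  rewrite (big_pred1 1%g) => [|s]; last first.
    apply/idP/eqP => [/perm_on_id->//|->]; exact: perm_on1.
  by rewrite /weight odd_perm1 mul1r; case: #|A| A1 => [|[]].
rewrite mul0r => /card_gt1P[x [y [xA yA xy]]].
have tA : perm_on A (tperm x y).
  apply: subset_trans (tperm_on x y) _; apply/subsetP=> z.
  by rewrite !inE => /orP[]/eqP->.
have wt s : weight true (tperm x y * s) = - weight true s.
  by rewrite weightM {1}/weight odd_tperm xy mulN1r.
suff : \sum_(s | perm_on A s) weight true s = - \sum_(s | perm_on A s) weight true s.
  by move=> h; lra.
rewrite {1}(reindex_inj (mulgI (tperm x y))) /= -sumrN.
apply: eq_big => [s|s _]; last exact: wt.
apply/idP/idP => h; last exact: perm_onM.
by rewrite -[s](mulKg (tperm x y)) perm_onM ?perm_onV.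
Qed.

Lemma card_pointed_subsets A x j : x \in A ->
  #|[set B : {set T} | (x \in B) && (B \subset A) & (#|B| == j.+1)]| = 'C(#|A|.-1, j).
Proof.
move=> xA; have -> : #|A|.-1 = #|A :\ x| by rewrite (cardsD1 x A) xA.
rewrite -cards_draws.
set S := [set B : {set T} | B \subset A :\ x & #|B| == j]; rewrite -(@card_in_imset _ _ (fun B => x |: B) S).
  apply: eq_card => B; rewrite inE; apply/idP/imsetP => [|[C]].
    case/andP=> /andP[xB BA] /eqP cB; exists (B :\ x); last by rewrite setD1K.
    rewrite inE setSD //=; apply/eqP.
    by move: cB; rewrite (cardsD1 x) xB => -[].
  rewrite inE subsetD1 => /andP[/andP[CA xC] /eqP cC] ->.

  by rewrite setU11 subUset sub1set xA CA cardsU1 xC cC /= eqxx.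
move=> B C; rewrite !inE !subsetD1 => /andP[/andP[_ xB] _] /andP[/andP[_ xC] _] h.
by rewrite -(setU1K xB) h setU1K.
Qed.

(** Group the sets [B] by size: with a = [#|A|.-1] there are C(a, i) of size i+1, and C(a, i) i!
    (a-i)! = a! for every i, so the factorials leave the sum. *)
Lemma sum_pointed_subsets A x (P : pred nat) (f : nat -> rat) : x \in A ->
  \sum_(B : {set T} | (x \in B) && (B \subset A) && P #|B|)
     (#|B|.-1`!)%:R * (#|A :\: B|`!)%:R * f #|B|
  = (#|A|.-1`!)%:R * \sum_(i < #|A| | P i.+1) f i.+1.
Proof.
move=> xA; have [a cA] : exists a, #|A| = a.+1.
  by exists #|A|.-1; rewrite prednK //; apply/card_gt0P; exists x.
have card_sub (B : {set T}) : x \in B -> B \subset A -> (0 < #|B| <= a.+1)%N.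
  by move=> xB BA; rewrite -cA subset_leq_card // andbT; apply/card_gt0P; exists x.
rewrite cA (partition_big (fun B : {set T} => inord #|B|.-1 : 'I_a.+1)
  (fun i => P i.+1)) /=; last first.
  move=> B /andP[/andP[xB BA] PB]; have cB := card_sub B xB BA.
  by rewrite inordK ?prednK //; lia.
rewrite mulr_sumr; apply: eq_bigr => i Pi.
transitivity (\sum_(B in [set B : {set T} | (x \in B) && (B \subset A) & (#|B| == i.+1)])
   (i`!)%:R * ((a - i)`!)%:R * f i.+1 : rat).
  apply: eq_big => [B|B].
    rewrite inE; case: (boolP (x \in B)) => //= xB.
    case: (boolP (B \subset A)) => //= BA; have cB := card_sub B xB BA.
    rewrite -(inj_eq val_inj) /= inordK; last by lia.
    by apply/andP/eqP => [[_ /eqP]|->]; [lia | split].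
  move=> /andP[/andP[/andP[xB BA] PB] /eqP/(congr1 val) /=].
  have cB := card_sub B xB BA; rewrite inordK; last by lia.
  move=> <-; rewrite prednK ?cardsD ?(setIidPr BA) ?cA; last by lia.
  by congr (_ * (_ `!)%:R * _); lia.
rewrite sumr_const card_pointed_subsets // cA -[LHS]mulr_natl !mulrA -!natrM -mulnA.
by rewrite bin_fact // -ltnS.
Qed.

(** Classify permutations by the orbit [B] of [x]: on [B] they form a single cycle, on the rest they
    are arbitrary. *)
Lemma sum_perm_on_porbit A x (F : {perm T} -> rat) : x \in A ->
  \sum_(s | perm_on A s) F s =
  \sum_(B : {set T} | (x \in B) && (B \subset A))
    \sum_(u | perm_on B u && (porbit u x == B))
      \sum_(v | perm_on (A :\: B) v) F (u * v)%g.
Proof.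
move=> xA; rewrite (partition_big (fun s => porbit s x)
  (fun B : {set T} => (x \in B) && (B \subset A))) /=; last first.
  by move=> s sA; rewrite porbit_id porbit_sub.
apply: eq_bigr => B /andP[xB BA].
have dBD : [disjoint B & A :\: B] by exact: disjoint_setDr.
(* An orbit is invariant, so the condition [s @: B == B] may be added; this gives the shape needed
   for the splitting. *)
transitivity (\sum_(s | perm_on A s && (s @: B == B))
    if porbit s x == B then F s else 0).
  rewrite -big_mkcondr; apply: eq_bigl => s; rewrite -andbA; congr (_ && _).
  by case: eqP => [<-|_]; rewrite ?andbF // im_porbit eqxx.
rewrite sum_perm_on_stab // big_mkcondr; apply: eq_bigr => u uB.
case: ifP => [/eqP uxB | uxB].
  by apply: eq_bigr => v vD; rewrite (porbit_mull uB vD dBD xB) uxB eqxx.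
by apply: big1 => v vD; rewrite (porbit_mull uB vD dBD xB) uxB.
Qed.

(** * Weighted number of full cycles *)

(** The weight of a single cycle of length [j]: its sign if [e] holds, and 1 otherwise. *)
Definition cycle_weight (e : bool) (j : nat) : rat := ((-1) ^+ e) ^+ j.-1.

(** In the signed case only the last two indices survive, and their signs are opposite. This is the
    identity to which the full-cycle counts are matched. *)
Lemma sum_cycle_weight e n : \sum_(i < n.+1)
    cycle_weight e i.+1 * (e ==> (n.+1 - i.+1 <= 1)%N)%:R
  = n.+1%:R * (e ==> (n.+1 <= 1)%N)%:R :> rat.
Proof.
rewrite /cycle_weight; case: e => /=; last first.
  under eq_bigr => i _ do rewrite expr1n mulr1.
  by rewrite sumr_const card_ord mulr1.
case: n => [|n]; first by rewrite big_ord1 /= !mul1r.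
rewrite mulr0 !big_ord_recr /= big1 => [|i _]; last first.
  by case: leqP => [|_]; rewrite ?mulr0 //; have := ltn_ord i; lia.
by rewrite subnn subSnn !expr1 exprS !mulr1 mulN1r add0r subrr.
Qed.

(* The signed number of full cycles is determined by the known sums over all
   permutations of the subsets of A, each split along the orbit of x. *)
Lemma sum_full_cycles e A x : x \in A ->
  \sum_(s | perm_on A s && (porbit s x == A)) weight e s
  = (#|A|.-1`!)%:R * cycle_weight e #|A|.
Proof.
have [n] := ubnP #|A|; elim: n A => // n IH A cA xA.
have := sum_perm_on_porbit (weight e) xA.
have inner (B : {set T}) :
    \sum_(u | perm_on B u && (porbit u x == B))
      \sum_(v | perm_on (A :\: B) v) weight e (u * v)%g
  = (\sum_(u | perm_on B u && (porbit u x == B)) weight e u)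
     * ((e ==> (#|A :\: B| <= 1)%N)%:R * (#|A :\: B|`!)%:R).
  rewrite -sum_weight_perm_on mulr_suml; apply: eq_bigr => u _.
  by rewrite mulr_sumr; apply: eq_bigr => v _; rewrite weightM.
rewrite (eq_bigr _ (fun B _ => inner B)).
have cA0 : (0 < #|A|)%N by apply/card_gt0P; exists x.
have := @sum_pointed_subsets A x (fun=> true)
  (fun j => cycle_weight e j * (e ==> (#|A| - j <= 1)%N)%:R) xA.
rewrite (eq_bigl _ _ (fun B => andbT _)).
have -> : \sum_(i < #|A|) cycle_weight e i.+1 * (e ==> (#|A| - i.+1 <= 1)%N)%:R
    = #|A|%:R * (e ==> (#|A| <= 1)%N)%:R :> rat.
  by rewrite -(prednK cA0) sum_cycle_weight.
rewrite sum_weight_perm_on mulrA -natrM mulnC -{2}(prednK cA0) -factS prednK //.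
rewrite mulrC => <-.
(* Only the term [B = A] is unknown; the terms of proper subsets agree by induction and cancel. *)
rewrite (bigD1 A) ?xA ?subxx // [in X in _ = X -> _](bigD1 A) ?xA ?subxx //=.
rewrite setDv cards0 subnn implybT fact0 !mulr1.
set X := (X in _ + X = _ -> _); set Y := (X in _ = _ + X -> _).
suff -> : X = Y by move=> /addIr/esym.
apply: eq_bigr => B /andP[/andP[xB BA] BnA].
rewrite IH //; last first.
  rewrite -ltnS (leq_trans _ cA) // ltnS proper_card // properEneq BnA BA //.
by rewrite cardsD (setIidPr BA); ring.
Qed.

(** * Permutations all of whose cycles are longer than k *)

Definition long_cycles k A s := [forall x in A, (k < #|porbit s x|)%N].

Definition long_sum k e A : rat :=
  \sum_(s | perm_on A s && long_cycles k A s) weight e s.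

Lemma long_cycles_mul k A B u v x :
  B \subset A -> x \in B -> perm_on B u -> porbit u x = B ->
  perm_on (A :\: B) v ->
  long_cycles k A (u * v)%g = (k < #|B|)%N && long_cycles k (A :\: B) v.
Proof.
move=> BA xB uB uxB vD.
have dBD : [disjoint B & A :\: B] by exact: disjoint_setDr.
apply/forall_inP/andP => [long|[kB /forall_inP long] y yA].
  split; first by rewrite -uxB -(porbit_mull uB vD dBD xB) long ?(subsetP BA).
  apply/forall_inP=> y yD; rewrite -(porbit_mulr uB vD dBD yD) long //.
  by move: yD; rewrite inE => /andP[].
have [yB|yNB] := boolP (y \in B); last first.
  have yD : y \in A :\: B by rewrite inE yNB.
  by rewrite (porbit_mulr uB vD dBD yD) long.
rewrite (porbit_mull uB vD dBD yB).
by have := yB; rewrite -{1}uxB -eq_porbit_mem => /eqP->; rewrite uxB.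
Qed.

(** Remove the cycle through [x]: its support [B] must have more than [k] points, the cycle on [B]
    is a full cycle, and what remains again has only long cycles. *)
Lemma long_sum_porbit k e A x : x \in A ->
  long_sum k e A =
  \sum_(B : {set T} | (x \in B) && (B \subset A) && (k < #|B|)%N)
    (#|B|.-1`!)%:R * cycle_weight e #|B| * long_sum k e (A :\: B).
Proof.
move=> xA; rewrite /long_sum big_mkcondr (sum_perm_on_porbit _ xA).
rewrite [RHS]big_mkcondr; apply: eq_bigr => B /andP[xB BA].
rewrite -(sum_full_cycles e xB); case: ifP => kB.
  rewrite mulr_suml; apply: eq_bigr => u /andP[uB /eqP uxB].
  rewrite -big_mkcondr mulr_sumr /=; apply: eq_big => [v|v].
    by case: (boolP (perm_on _ v)) => //= vD; rewrite (long_cycles_mul _ BA xB) ?kB.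
  by rewrite weightM.
apply: big1 => u /andP[uB /eqP uxB]; apply: big1 => v vD.
by rewrite (long_cycles_mul _ BA xB) ?kB.
Qed.

End PermutationSums.

(** * The normalised counts and their recursion *)

(** The c(n) of the overview for [e = false], and d(n) for [e = true]. *)
Definition long_ratio k e n : rat := long_sum k e [set: 'I_n] / (n`!)%:R.

Lemma fact_neq0 n : (n`!)%:R != 0 :> rat.
Proof. by rewrite pnatr_eq0 -lt0n fact_gt0. Qed.

Lemma long_sum0 k e (T : finType) (A : {set T}) : #|A| = 0%N -> long_sum k e A = 1.
Proof.
move=> /cards0_eq ->; rewrite /long_sum (big_pred1 1%g) ?/weight ?odd_perm1 ?andbF // => s.
apply/andP/eqP => [[/perm_on_id->]//|->]; first by rewrite cards0.
by split; [exact: perm_on1 | apply/forall_inP=> x; rewrite inE].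
Qed.

(* The case A = [set: 'I_n] of the recursion identifies the constant, so the induction
   proves at once that [long_sum] depends only on the cardinal. *)
Lemma long_sum_rec_aux k e n :
  (forall (T : finType) (A : {set T}), (#|A| <= n)%N ->
    long_sum k e A = (#|A|`!)%:R * long_ratio k e #|A|) ->
  forall (T : finType) (A : {set T}), #|A| = n.+1 ->
    long_sum k e A =
    (n`!)%:R * \sum_(i < n.+1 | (k <= i)%N) ((-1) ^+ e) ^+ i * long_ratio k e (n - i).
Proof.
move=> IH T A cA; have /card_gt0P[x xA] : (0 < #|A|)%N by rewrite cA.
rewrite (long_sum_porbit _ _ xA).
have := @sum_pointed_subsets _ A x (fun j => (k < j)%N)
  (fun j => cycle_weight e j * long_ratio k e (n.+1 - j)) xA.
have -> : (#|A|.-1`!)%:R * \sum_(i < #|A| | (k < i.+1)%N)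
    cycle_weight e i.+1 * long_ratio k e (n.+1 - i.+1)
  = (n`!)%:R * \sum_(i < n.+1 | (k <= i)%N) ((-1) ^+ e) ^+ i * long_ratio k e (n - i).
  by rewrite cA.
move=> <-.
apply: eq_bigr => B /andP[/andP[xB BA] _].
have cAB : #|A :\: B| = (n.+1 - #|B|)%N by rewrite cardsD (setIidPr BA) cA.
have B0 : (0 < #|B|)%N by apply/card_gt0P; exists x.
rewrite IH ?cAB; first by ring.
by lia.
Qed.

Lemma long_sumE k e (T : finType) (A : {set T}) :
  long_sum k e A = (#|A|`!)%:R * long_ratio k e #|A|.
Proof.
have [n] := ubnP #|A|; elim: n T A => // n IH T A; rewrite ltnS => cA.
case E: #|A| => [|m].
  by rewrite long_sum0 // /long_ratio long_sum0 ?cardsT ?card_ord ?divr1 ?mulr1.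
have IHm (U : finType) (B : {set U}) : (#|B| <= m)%N ->
    long_sum k e B = (#|B|`!)%:R * long_ratio k e #|B|.
  by move=> cB; apply: IH; lia.
rewrite (long_sum_rec_aux IHm E) /long_ratio.
rewrite (long_sum_rec_aux IHm (_ : #|[set: 'I_m.+1]| = m.+1)) ?cardsT ?card_ord //.
by rewrite [RHS]mulrC divfK ?fact_neq0.
Qed.

Lemma long_ratio0 k e : long_ratio k e 0 = 1.
Proof. by rewrite /long_ratio long_sum0 ?cardsT ?card_ord ?divr1. Qed.

Lemma long_ratioS_sum k e n : n.+1%:R * long_ratio k e n.+1 =
  \sum_(i < n.+1 | (k <= i)%N) ((-1) ^+ e) ^+ i * long_ratio k e (n - i).
Proof.
have h (T : finType) (A : {set T}) : (#|A| <= n)%N ->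
   long_sum k e A = (#|A|`!)%:R * long_ratio k e #|A| by move=> _; exact: long_sumE.
have := long_sum_rec_aux h (_ : #|[set: 'I_n.+1]| = n.+1).
rewrite long_sumE cardsT card_ord => /(_ erefl).
rewrite factS mulnC natrM -mulrA => /mulfI -> //; exact: fact_neq0.
Qed.

(** Shifting the index by one turns the tail of the sum for [n.+1] into (-1)^e times the sum for
    [n]; only the term of index [k], if present, is left over. *)
Lemma long_ratioS k e n : n.+1%:R * long_ratio k e n.+1 =
  (-1) ^+ e * (n%:R * long_ratio k e n)
  + (if (k <= n)%N then ((-1) ^+ e) ^+ k * long_ratio k e (n - k) else 0).
Proof.
rewrite long_ratioS_sum -(big_geq_mkord k n.+1 xpredT
  (fun i => ((-1) ^+ e) ^+ i * long_ratio k e (n - i))).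
have [kn|nk] := leqP k n; last first.
  rewrite addr0 big_geq //; case: n nk => [|n] nk; first by rewrite mul0r mulr0.
  by rewrite long_ratioS_sum big_pred0 ?mulr0 // => i; have := ltn_ord i; lia.
rewrite big_ltn // addrC; congr (_ + _).
case: n kn => [|n] kn; first by rewrite big_geq // mul0r mulr0.
rewrite long_ratioS_sum -(big_geq_mkord k n.+1 xpredT
  (fun i => ((-1) ^+ e) ^+ i * long_ratio k e (n - i))).
rewrite big_add1 mulr_sumr; apply: eq_bigr => i _.
by rewrite exprS mulrA subSS.
Qed.

Lemma long_ratio_eq0 k e n : (0 < n <= k)%N -> long_ratio k e n = 0.
Proof.
case: n => // n nk; apply/eqP; rewrite -(mulrI_eq0 _ (mulfI (_ : n.+1%:R != 0 :> rat))).
  by rewrite long_ratioS_sum big_pred0 // => i; have := ltn_ord i; lia.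
by rewrite pnatr_eq0.
Qed.

(** Two cycles longer than k need 2k+2 points, so here the permutation is a single cycle: there are
    n! of these, of sign (-1)^n. *)
Lemma long_ratio_mid k e n : (k <= n <= k.*2)%N ->
  n.+1%:R * long_ratio k e n.+1 = ((-1) ^+ e) ^+ n.
Proof.
elim: n => [|n IH] kn; rewrite long_ratioS; case: leqP => [kn'|]; try lia.
  by have -> : k = 0%N by [lia]; rewrite mul0r mulr0 add0r mul1r long_ratio0.
have [knE|kn''] := eqVneq k n.+1.
  subst k; rewrite subnn long_ratio0 mulr1 long_ratio_eq0 ?leqnn //.
  by rewrite !mulr0 add0r.
rewrite [long_ratio _ _ (_ - _)]long_ratio_eq0; last by lia.
by rewrite IH ?mulr0 ?addr0 -?exprS //; lia.
Qed.

(** * General bounds on the normalised counts *)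

(** By the recursion c(n+1) is an average of c(n) and c(n-k) with weights n/(n+1) and 1/(n+1), so a
    lower bound propagates from the sizes k+1 to 2k+1, where c(N) = 1/N. *)
Lemma long_ratio_ge k n : (k < n)%N -> (k.*2.+1)%:R^-1 <= long_ratio k false n.
Proof.
have [m] := ubnP n; elim: m n => // m IH [//|n] nm kn.
have n0 : (0 : rat) < n.+1%:R by rewrite ltr0n.
have k0 : (0 : rat) < k.*2.+1%:R by rewrite ltr0n.
have [nk|kn2] := leqP n k.*2.
  have := @long_ratio_mid k false n; rewrite !expr1n => /(_ _) h.
  have {}h : n.+1%:R * long_ratio k false n.+1 = 1 by apply: h; lia.
  rewrite -(ler_pM2l n0) h ler_pdivrMr // mul1r ler_nat; lia.
rewrite -(ler_pM2l n0) long_ratioS expr1n !mul1r.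
have -> : (k <= n)%N by lia.
have h1 : (k.*2.+1)%:R^-1 <= long_ratio k false n by apply: IH; lia.
have h2 : (k.*2.+1)%:R^-1 <= long_ratio k false (n - k) by apply: IH; lia.
by rewrite -natr1 mulrDl mul1r lerD // ler_wpM2l.
Qed.

(** The same averaging, with the triangle inequality absorbing the signs. *)
Lemma norm_long_ratio_le k e n : (0 < n)%N -> `|long_ratio k e n| <= k.+1%:R^-1.
Proof.
have [m] := ubnP n; elim: m n => // m IH [//|n] nm _.
have n0 : (0 : rat) < n.+1%:R by rewrite ltr0n.
have k0 : (0 : rat) < k.+1%:R by rewrite ltr0n.
have [nk|kn] := ltnP n k.
  by rewrite long_ratio_eq0 ?normr0 ?invr_ge0 ?ltW //; lia.
rewrite -(ler_pM2l n0) -{1}(ger0_norm (ltW n0)) -normrM.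
(* The case [n = k] is separate because the recursion then reaches size 0, where the ratio is 1 and
   the bound can fail. *)
have [nkE|nk] := eqVneq n k.
  subst k; rewrite long_ratio_mid; last by lia.
  by rewrite !normrX normrN1 !expr1n divff ?gt_eqF.
rewrite long_ratioS kn -natr1 mulrDl mul1r (le_trans (ler_normD _ _)) //.
rewrite (normrM ((-1) ^+ e)) (normrM n%:R) (normrM (((-1) ^+ e) ^+ k)).
rewrite !normrX normrN1 !expr1n !mul1r normr_nat lerD //; last by apply: IH; lia.
case: n nm {n0} kn nk => [|n] nm kn nk; first by rewrite !mul0r.
by rewrite ler_wpM2l // IH //; lia.
Qed.

(** Since (n+1) d(n+1) = -n d(n) + (-1)^k d(n-k), adding (n+1) d(n) cancels the large terms and
    leaves d(n) + (-1)^k d(n-k). This gains a factor of order 1/n over bounding the two summands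
    separately. *)
Lemma norm_long_ratio_add k n : (k < n)%N ->
  `|long_ratio k true n.+1 + long_ratio k true n| <= 2 / (n.+1%:R * k.+1%:R).
Proof.
move=> kn; have n0 : (0 : rat) < n.+1%:R by rewrite ltr0n.
rewrite -(ler_pM2l n0) -{1}(ger0_norm (ltW n0)) -normrM.
have -> : n.+1%:R * (long_ratio k true n.+1 + long_ratio k true n)
   = long_ratio k true n + (-1) ^+ k * long_ratio k true (n - k).
  rewrite mulrDr long_ratioS (ltnW kn) -(natr1 n) expr1; ring.
have -> : n.+1%:R * (2 / (n.+1%:R * k.+1%:R)) = k.+1%:R^-1 + k.+1%:R^-1 :> rat.
  by field; rewrite !(addrC 1) !natr1 !pnatr_eq0.
rewrite (le_trans (ler_normD _ _)) // (normrM ((-1) ^+ k)) normrX normrN1 expr1n mul1r.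
by rewrite lerD // norm_long_ratio_le //; lia.
Qed.

(** * Points on short cycles and derangements on k-sets *)

Definition short_points (T : finType) k (s : {perm T}) :=
  [set x | (#|porbit s x| <= k)%N].

(** A sufficient condition for a derangement on k-sets that can be counted exactly. It is not
    necessary: three 2-cycles on six points fix no 3-set. *)
Definition few_short_points n k (s : 'S_n) := (#|short_points k s| < k)%N.

Lemma few_short_points_derangement n k (s : 'S_n) :
  few_short_points k s -> kset_derangement k s.
Proof.
move=> few; apply/forallP=> S; apply/implyP=> /eqP cS; apply/eqP=> sS.
have iterS i x : x \in S -> (s ^+ i)%g x \in S.
  move=> xS; elim: i => [|i IH]; first by rewrite perm1.
  by rewrite expgSr permM -sS imset_f.
suff SB : S \subset short_points k s.
  by have := subset_leq_card SB; rewrite cS leqNgt => /negP.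
apply/subsetP=> x xS; rewrite inE -cS subset_leq_card //.
by apply/subsetP=> _ /porbitP[i ->]; exact: iterS.
Qed.

Lemma kset_derangement1 n (s : 'S_n) :
  kset_derangement 1 s -> fixed_point_free s.
Proof.
move=> /forallP ders; apply/forallP=> i; have := ders [set i].
by rewrite cards1 eqxx imset_set1 /=; apply: contra => /eqP ->.
Qed.

(** Fix the set [B] of short points, of size m: the permutation is arbitrary on [B] and has only
    long cycles elsewhere. The C(n, m) choices of [B] turn m! (n-m)! into n!. *)
Lemma sum_few_short_points n k e : (k <= n)%N ->
  \sum_(s : 'S_n | few_short_points k s) weight e s =
  (n`!)%:R * \sum_(m < k) (e ==> (m <= 1)%N)%:R * long_ratio k e (n - m).
Proof.
move=> kn; rewrite (partition_big (short_points k)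
  (fun B : {set 'I_n} => (#|B| < k)%N)) //=.
have inner (B : {set 'I_n}) : (#|B| < k)%N ->
    \sum_(s : 'S_n | few_short_points k s && (short_points k s == B)) weight e s
  = (e ==> (#|B| <= 1)%N)%:R * (#|B|`!)%:R
    * (((n - #|B|)`!)%:R * long_ratio k e (n - #|B|)).
  move=> Bk; have cB : #|[set: 'I_n] :\: B| = (n - #|B|)%N.
    by rewrite cardsD setTI cardsT card_ord.
  rewrite -cB -long_sumE -sum_weight_perm_on.
  have dBD : [disjoint B & [set: 'I_n] :\: B] by exact: disjoint_setDr.
  transitivity (\sum_(s : 'S_n | perm_on [set: 'I_n] s && (s @: B == B))
      if short_points k s == B then weight e s else 0).
    rewrite -big_mkcondr; apply: eq_bigl => s.
    have -> : perm_on [set: 'I_n] s by apply/subsetP=> x; rewrite inE.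
    apply/andP/andP => [[_ /eqP sB]|[_ /eqP sB]].
      rewrite sB eqxx; split=> //; rewrite eqEcard card_imset ?leqnn ?andbT.
        rewrite -sB; apply/subsetP=> _ /imsetP[x xB ->]; move: xB.
        by have := porbit_perm s 1 x; rewrite expg1 !inE => ->.
      exact: perm_inj.
    by rewrite /few_short_points sB eqxx.
  rewrite sum_perm_on_stab ?subsetT // mulr_suml; apply: eq_bigr => u uB.
  rewrite -big_mkcondr mulr_sumr; apply: eq_big => [v|v]; last by rewrite weightM.
  case: (boolP (perm_on _ v)) => //= vD; apply/eqP/forall_inP => [sB x xD|long].
    rewrite ltnNge -(porbit_mulr uB vD dBD xD); apply/negP=> short.
    have : x \in short_points k (u * v)%g by rewrite inE.
    by rewrite sB; move: xD; rewrite inE => /andP[/negPf->].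
  (* As [B] has fewer than [k] points, every cycle inside [B] is automatically short. *)
  apply/setP=> x; rewrite inE; have [xB|xNB] := boolP (x \in B).
    rewrite (porbit_mull uB vD dBD xB) (leq_trans _ (ltnW Bk)) //.
    exact/subset_leq_card/porbit_sub.
  have xD : x \in [set: 'I_n] :\: B by rewrite !inE xNB.
  by rewrite (porbit_mulr uB vD dBD xD) leqNgt long.
rewrite (eq_bigr _ inner); case: k kn {inner} => [|k] kn.
  by rewrite big_ord0 mulr0 big1.
rewrite (partition_big (fun B : {set 'I_n} => inord #|B| : 'I_k.+1) xpredT) //=.
rewrite mulr_sumr; apply: eq_bigr => m _.
transitivity (\sum_(B in [set B : {set 'I_n} | #|B| == m])
   ((e ==> (m <= 1)%N)%:R * (m`!)%:R
    * (((n - m)`!)%:R * long_ratio k.+1 e (n - m)))).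
  apply: eq_big => [B|B /andP[Bk /eqP/(congr1 val) /=]]; last by rewrite inordK // => ->.
  rewrite inE; apply/andP/eqP => [[Bk /eqP/(congr1 val) /=]|cB]; first by rewrite inordK.
  by rewrite cB ltn_ord; split=> //; apply/eqP/val_inj; rewrite /= inordK.
have mn : (m <= n)%N by have := ltn_ord m; lia.
rewrite sumr_const card_draws card_ord -[LHS]mulr_natl -(bin_fact mn) !natrM.
ring.
Qed.

(** * Restriction to a coset of the alternating group *)

Lemma coset_AltE n (g s : 'S_n) : (s \in g *: 'Alt_('I_n))%g = (odd_perm s == odd_perm g).
Proof.
by rewrite mem_lcoset Alt_even odd_permM odd_permV; case: (odd_perm g); case: (odd_perm s).
Qed.

(** Twice the indicator of the coset of g is 1 + sgn(g) sgn(s). *)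
Lemma card_coset_Alt_pred n (g : 'S_n) (P : pred 'S_n) :
  2 * #|[set s in (g *: 'Alt_('I_n))%g | P s]|%:R =
  \sum_(s | P s) weight false s + (-1) ^+ odd_perm g * \sum_(s | P s) weight true s.
Proof.
rewrite -sum1_card natr_sum mulr_sumr mulr_sumr -big_split /=.
rewrite big_mkcond [RHS]big_mkcond; apply: eq_bigr => s _.
rewrite inE coset_AltE /weight /=; case: (P s); rewrite ?andbF // andbT.
by case: (odd_perm g); case: (odd_perm s); rewrite /=; ring.
Qed.

Lemma proportion_few_short_points n k (g : 'S_n) : (1 < n)%N -> (k <= n)%N ->
  proportion (g *: 'Alt_('I_n))%g (@few_short_points n k) =
  \sum_(m < k) long_ratio k false (n - m)
  + (-1) ^+ odd_perm g * \sum_(m < k) (m <= 1)%N%:R * long_ratio k true (n - m).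
Proof.
move=> n1 kn; rewrite /proportion card_lcoset.
have cAlt : 2 * #|('Alt_('I_n))%g|%:R = (n`!)%:R :> rat.
  by rewrite -natrM card_Alt card_ord.
have A0 : #|('Alt_('I_n))%g|%:R != 0 :> rat.
  by apply: contra (fact_neq0 n) => /eqP A0; rewrite -cAlt A0 mulr0.
have := card_coset_Alt_pred g (@few_short_points n k).
rewrite !sum_few_short_points // -cAlt.
under [\sum_(m < k) (false ==> _)%:R * _]eq_bigr => m _ do rewrite mul1r.
have two0 : 2 != 0 :> rat by [].
move=> cP; apply: (canLR (mulfK A0)); apply: (mulfI two0).
by rewrite [LHS]cP [RHS]mulrCA [RHS]mulrDl -[X in _ = _ + X]mulrA;
  congr (_ + _ * _); rewrite mulrC.
Qed.

Lemma ler_proportion (T : finType) (C : {set T}) (P Q : pred T) :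
  subpred P Q -> proportion C P <= proportion C Q.
Proof.
move=> PQ; rewrite /proportion ler_wpM2r ?invr_ge0 ?ler0n // ler_nat.
by apply/subset_leq_card/subsetP=> x; rewrite !inE => /andP[-> /PQ].
Qed.

(** * The case k = 1: derangement numbers *)

Lemma long_ratio1S e n : n.+2%:R * long_ratio 1 e n.+2 =
  (-1) ^+ e * (n.+1%:R * long_ratio 1 e n.+1 + long_ratio 1 e n).
Proof. by rewrite long_ratioS /= subn1 expr1 mulrDr. Qed.

(** The constant is c(5) = 44/120. Each later value is an average of the two preceding ones, so
    checking sizes 5 and 6 suffices. *)
Lemma long_ratio1_ge n : (5 <= n)%N -> 11 / 30 <= long_ratio 1 false n.
Proof.
have := long_ratio1S false; have := @long_ratio_eq0 1 false 1 isT.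
have := long_ratio0 1 false; move: (long_ratio 1 false) => r r0 r1 rec.
have [r5 r6] : 11 / 30 <= r 5 /\ 11 / 30 <= r 6.
  move: (rec 0%N) (rec 1%N) (rec 2%N) (rec 3%N) (rec 4%N).
  rewrite r0 r1 !mul1r; move: (r 2) (r 3) (r 4) (r 5) (r 6) => *; split; lra.
move: (11 / 30) r5 r6 => b r5 r6.
have [m] := ubnP n; elim: m n => // m IH n nm n5.
case: n nm n5 => [|[|[|[|[|[|[|n]]]]]]] // nm _.
have n0 : (0 : rat) < n.+4.+3%:R by rewrite ltr0n.
rewrite -(ler_pM2l n0) rec mul1r -natr1 mulrDl mul1r lerD ?IH //; last by lia.
by rewrite ler_wpM2l // IH //; lia.
Qed.

(** The constant is d(5) = 4/120, and the averaging argument applies to absolute values. *)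
Lemma norm_long_ratio1_le n : (5 <= n)%N -> `|long_ratio 1 true n| <= 1 / 30.
Proof.
have := long_ratio1S true; have := @long_ratio_eq0 1 true 1 isT.
have := long_ratio0 1 true; move: (long_ratio 1 true) => r r0 r1 rec.
have [r5 r6] : `|r 5%N| <= 1 / 30 /\ `|r 6%N| <= 1 / 30.
  move: (rec 0%N) (rec 1%N) (rec 2%N) (rec 3%N) (rec 4%N).
  rewrite r0 r1 expr1 !mulN1r.
  by move: (r 2) (r 3) (r 4) (r 5) (r 6) => *; split; rewrite ler_norml; apply/andP; split; lra.
move: (1 / 30) r5 r6 => b r5 r6.
have [m] := ubnP n; elim: m n => // m IH n nm n5.
case: n nm n5 => [|[|[|[|[|[|[|n]]]]]]] // nm _.
have n0 : (0 : rat) < n.+4.+3%:R by rewrite ltr0n.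
rewrite -(ler_pM2l n0) -{1}(ger0_norm (ltW n0)) -normrM rec expr1 mulN1r normrN.
rewrite -(natr1 n.+4.+2) [leRHS]mulrDl mul1r (le_trans (ler_normD _ _)) // lerD ?IH //; last by lia.
by rewrite normrM normr_nat ler_wpM2l // IH //; lia.
Qed.

(** * The case k > 1 *)

Lemma sum_long_ratio_ge n k : (k.*2 <= n)%N ->
  k%:R / (k.*2.+1)%:R <= \sum_(m < k) long_ratio k false (n - m).
Proof.
move=> kn; rewrite -[k in k%:R]card_ord mulr_natl -sumr_const.
by apply: ler_sum => m _; apply: long_ratio_ge; have := ltn_ord m; lia.
Qed.

Lemma long_ratio2S e n : n.+3%:R * long_ratio 2 e n.+3 =
  (-1) ^+ e * (n.+2%:R * long_ratio 2 e n.+2) + long_ratio 2 e n.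
Proof. by rewrite long_ratioS /= subn2 sqrr_sign mul1r. Qed.

(** The sizes for [k = 2] that the general estimate misses, computed from the recursion; at [n = 6]
    both sides equal 4/45. *)
Lemma norm_long_ratio2_add_le n : (4 <= n < 10)%N ->
  `|long_ratio 2 true n + long_ratio 2 true n.-1| <=
  long_ratio 2 false n + long_ratio 2 false n.-1 - 1 / 3.
Proof.
move: (long_ratio2S false) (long_ratio2S true) (long_ratio0 2 false) (long_ratio0 2 true).
move: (@long_ratio_eq0 2 false 1 isT) (@long_ratio_eq0 2 true 1 isT).
move: (@long_ratio_eq0 2 false 2 isT) (@long_ratio_eq0 2 true 2 isT).
move: (long_ratio 2 false) (long_ratio 2 true) => c d c2 d2 c1 d1 recc recd c0 d0.
move: (recc 0%N) (recc 1%N) (recc 2%N) (recc 3%N) (recc 4%N) (recc 5%N) (recc 6%N).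
move: (recd 0%N) (recd 1%N) (recd 2%N) (recd 3%N) (recd 4%N) (recd 5%N) (recd 6%N).
rewrite c0 c1 c2 d0 d1 d2 expr1 expr0 {recc recd c0 c1 c2 d0 d1 d2}.
case: n => [|[|[|[|[|[|[|[|[|[|n]]]]]]]]]] //= *; rewrite ler_norml; apply/andP; split; lra.
Qed.

Lemma le_proportion_few_short_points n k (g : 'S_n) : (1 < k)%N -> (k.*2 <= n)%N ->
  1 / 3 <= proportion (g *: 'Alt_('I_n))%g (@few_short_points n k).
Proof.
move=> k2 kn; rewrite proportion_few_short_points; [|lia|lia].
have -> : \sum_(m < k) (m <= 1)%N%:R * long_ratio k true (n - m)
    = long_ratio k true n + long_ratio k true n.-1.
  case: k k2 {kn} => [|[|k]] // _; rewrite !big_ord_recl big1 /= => [|i _].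
    by rewrite !mul1r addr0 subn0 subn1.
  by rewrite /bump /= mul0r.
(* From here on the sign of [g] is taken to be the worse one. *)
have signE x : - `|x| <= (-1) ^+ odd_perm g * x :> rat.
  case: (odd_perm g); last by rewrite mul1r lerNnormlW.
  by rewrite expr1 mulN1r lerN2 ler_norm.
apply: le_trans (lerD (lexx _) (signE _)).
have [[kE n10]|big] : (k = 2%N /\ (n < 10)%N) \/ ((2 < k) || (10 <= n))%N by lia.
  subst k; rewrite !big_ord_recl big_ord0 /= addr0 subn0 subn1.
  by rewrite lerBrDr addrC -lerBrDr norm_long_ratio2_add_le //; lia.
have sum_ge := sum_long_ratio_ge kn.
have norm_le : `|long_ratio k true n + long_ratio k true n.-1| <= 2 / (n%:R * k.+1%:R).
  by have := @norm_long_ratio_add k n.-1; rewrite prednK; [apply; lia | lia].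
suff : 1 / 3 <= k%:R / (k.*2.+1)%:R - 2 / (n%:R * k.+1%:R) :> rat.
  by move=> h; apply: le_trans h _; rewrite lerB.
rewrite -!natr1 -mul2n natrM.
have {}kn : 2 * k%:R <= n%:R :> rat by rewrite -natrM mul2n ler_nat.
have {}k2 : 2 <= k%:R :> rat by rewrite ler_nat.
have {}big : (3 <= k%:R :> rat) || (10 <= n%:R :> rat) by rewrite !ler_nat.
move: (k%:R : rat) (n%:R : rat) kn k2 big {sum_ge norm_le signE} => K N KN K2 big.
(* As K/(2K+1) exceeds 1/3 by (K-1)/(3(2K+1)), the goal amounts to this inequality. It follows from
   N >= 2K when K >= 3, and from N >= 10 otherwise, with equality at K = 2, N = 10. *)
have key : 6 * (2 * K + 1) <= (K - 1) * (N * (K + 1)).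
  case/orP: big => [K3|N10].
    have : 0 <= (K ^+ 2 - 1) * (N - 2 * K) by apply: mulr_ge0; nra.
    by nra.
  have : 0 <= (K ^+ 2 - 1) * (N - 10) by apply: mulr_ge0; nra.
  by nra.
have D1 : 0 < 2 * K + 1 by lra.
have D2 : 0 < N * (K + 1) by apply: mulr_gt0; lra.
have -> : K / (2 * K + 1) = 1 / 3 + (K - 1) / (3 * (2 * K + 1)).
  by field; lra.
rewrite -[leRHS]addrA lerDl subr_ge0 ler_pdivrMr // mulrAC ler_pdivlMr; last by lra.
lra.
Qed.

Local Close Scope ring_scope.

Theorem theorem3p4 (n : nat) (g : 'S_n) :
  [/\ forall k : nat, 2 <= k -> k.*2 <= n ->
        (1 / 3 <= proportion (g *: 'Alt_('I_n))%g (kset_derangement k))%R,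
      5 <= n ->
        (1 / 3 <= proportion (g *: 'Alt_('I_n))%g (@fixed_point_free n))%R
    & 5 <= n ->
        simple ('Alt_('I_n))%g /\
        forall k : nat, 1 <= k -> k.*2 <= n ->
          (1 / 3 <= proportion (g *: 'Alt_('I_n))%g (kset_derangement k))%R].
Proof.
have ge2 k : 2 <= k -> k.*2 <= n ->
    (1 / 3 <= proportion (g *: 'Alt_('I_n))%g (kset_derangement k))%R.
  move=> k2 kn; apply: le_trans (le_proportion_few_short_points g k2 kn) _.
  by apply: ler_proportion => s; exact: few_short_points_derangement.
have eq1 : 5 <= n ->
    (1 / 3 <= proportion (g *: 'Alt_('I_n))%g (kset_derangement 1))%R.
  move=> n5; apply: le_trans (ler_proportion _
    (@few_short_points_derangement n 1)).
  rewrite proportion_few_short_points; [|lia|lia].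
  rewrite !big_ord1 subn0.
  (* The two bounds leave exactly 11/30 - 1/30 = 1/3. *)
  have := long_ratio1_ge n5; have := norm_long_ratio1_le n5.
  move: (long_ratio 1 false n) (long_ratio 1 true n) => c d.
  rewrite ler_norml => /andP[d1 d2] c1.
  by case: (odd_perm g); rewrite /= ?expr1 ?mul1r; lra.
split=> // n5.
  apply: le_trans (eq1 n5) _; apply: ler_proportion => s.
  exact: kset_derangement1.
split; first by apply: simple_Alt5; rewrite card_ord.
move=> [|[|k]] // _ kn; [exact: eq1 | exact: ge2].
Qed.
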